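(* Let $M>m>0$ be real numbers, let $\mathcal{H}$ be a complex Hilbert space and let $A\in\mathcal{B}(\mathcal{H})$. If $C_{M,m}(A)$ and $C_{M,m}(\mathrm{i}A^* )$ are accretive, then $$\omega(A)\le \frac{M+m}{2\sqrt{Mm}}\sqrt{\|\mathfrak{R}A\|\,\|\mathfrak{I}A\|}.$$
   Context: $\mathcal{B}(\mathcal{H})$ is the algebra of bounded linear operators on $\mathcal{H}$, with identity $I$ and operator norm $\|\cdot\|$. $C_{M,m}(T)=(MI-T^* )(T-mI)$; $\mathfrak{R}T=\frac{T+T^*}{2}$ and $\mathfrak{I}T=\frac{T-T^*}{2\mathrm{i}}$. $T$ is accretive if $\mathfrak{R}T$ is positive semi-definite. The numerical radius is $\omega(T)=\sup\{|\langle Tx,x\rangle|: x\in\mathcal{H},\ \|x\|=1\}$. *)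

(* Defs.v *)
From HB Require Import structures.
From mathcomp Require Import all_boot all_order all_algebra sesquilinear complex.
From mathcomp Require Import all_classical all_reals topology normedtype.
From mathcomp Require Import ring lra.

Set Implicit Arguments.
Unset Strict Implicit.
Unset Printing Implicit Defensive.

Import Order.TTheory GRing.Theory Num.Theory.
Import numFieldNormedType.Exports.

Local Open Scope classical_set_scope.
Local Open Scope ring_scope.
Local Open Scope complex_scope.

(* The inner product is linear in its first argument and conjugate-linear in
   the second one, and it induces the (complete) norm of the space. *)
Record hilbertSpace (R : realType) := HilbertSpace {
  hilbert_sort :> completeNormedModType R[i];
  inner : {dot hilbert_sort for Num.conj};
  norm_inner : forall x : hilbert_sort, `|x| ^+ 2 = inner x x }.

Notation "''[' x , y ]" := (inner _ x y) : ring_scope.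

(* The norm of a normed module over R[i], and the modulus of a complex number,
   take their values in R[i]; rnorm is the same norm with values in R
   (see rnormE). *)
Definition rnorm (R : realType) (V : normedZmodType R[i]) (x : V) : R :=
  complex.Re `|x|.

Record boundedOp (R : realType) (H : hilbertSpace R) := BoundedOp {
  op_fun :> H -> H;
  op_linear : linear op_fun;
  op_bounded : exists k : R, forall x : H, rnorm (op_fun x) <= k * rnorm x }.

HB.instance Definition _ (R : realType) (H : hilbertSpace R) (T : boundedOp H) :=
  GRing.isLinear.Build R[i] H H *:%R (op_fun T) (op_linear T).

Section Norm.
Variable R : realType.

Lemma rnormE (V : normedZmodType R[i]) (x : V) : `|x| = (rnorm x)%:C.
Proof. by rewrite /rnorm RRe_real ?normr_real. Qed.

Lemma rnorm_ge0 (V : normedZmodType R[i]) (x : V) : 0 <= rnorm x.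
Proof. by rewrite -ler0c -rnormE. Qed.

Lemma rnormD (V : normedZmodType R[i]) (x y : V) :
  rnorm (x + y) <= rnorm x + rnorm y.
Proof. by rewrite -lecR rmorphD /= -!rnormE ler_normD. Qed.

Lemma rnormZ (V : normedModType R[i]) (a : R[i]) (x : V) :
  rnorm (a *: x) = rnorm a * rnorm x.
Proof. by apply: complexI; rewrite rmorphM /= -!rnormE normrZ. Qed.

Lemma rnorm0 (V : normedZmodType R[i]) : rnorm (0 : V) = 0.
Proof. by rewrite /rnorm normr0. Qed.

Variable H : hilbertSpace R.
Implicit Types (x y z : H) (T S : boundedOp H).

Lemma innerC x y : '[x, y] = ('[y, x])^*.
Proof. by rewrite hermC /= expr0 mul1r. Qed.

Lemma rnorm_sqr x : '[x, x] = (rnorm x ^+ 2)%:C.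
Proof. by rewrite -norm_inner rnormE rmorphXn. Qed.

Lemma cauchy_schwarz x y : rnorm '[x, y] <= rnorm x * rnorm y.
Proof.
have [->|y0] := eqVneq y 0.
  by rewrite linear0r rnorm0 rnorm0 mulr0.
have yy0 : 0 < '[y, y] by rewrite dnorm_gt0.
have h : 0 <= '['[y, y] *: x - '[x, y] *: y, '[y, y] *: x - '[x, y] *: y].
  exact: dnorm_ge0.
rewrite -lecR -(@ler_pXn2r _ 2) ?nnegrE ?ler0c ?rnorm_ge0 ?mulr_ge0 ?rnorm_ge0 //.
rewrite rmorphM exprMn /= -!rnormE !norm_inner.
rewrite -(ler_pM2l yy0) -subr_ge0; apply: le_trans h _.
rewrite le_eqVlt; apply/orP; left; apply/eqP.
rewrite normCK -[Num.conj _]/(('[x, y])^*) -innerC.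
rewrite linearBl !linearBr /= !linearZl_LR !linearZr_LR /=.
rewrite -![Num.conj _]/(_^*) -!innerC.
ring.
Qed.

(* If t |-> Z t^2 + 2 b t is bounded below by - d on R then b^2 <= d (Z + 1). *)
Lemma quad_lower_bound (Z b d : R) : 0 <= Z ->
  (forall t : R, - d <= t ^+ 2 * Z + 2 * t * b) -> b ^+ 2 <= d * (Z + 1).
Proof.
move=> Z0 /(_ (- b / (Z + 1))).
have Z1 : 0 < Z + 1 by rewrite ltr_wpDl.
have -> : (- b / (Z + 1)) ^+ 2 * Z + 2 * (- b / (Z + 1)) * b =
    - b ^+ 2 / (Z + 1) - b ^+ 2 / (Z + 1) ^+ 2.
  by field; rewrite gt_eqF.
move=> h; rewrite -ler_pdivrMr //.
have : 0 <= b ^+ 2 / (Z + 1) ^+ 2 by rewrite divr_ge0 ?sqr_ge0.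
by move: h; rewrite mulNr; lra.
Qed.

Section Riesz.
Variables (f : H -> R[i]) (k : R).
Hypothesis f_lin : linear_for *%R f.
Hypothesis f_bnd : forall x, rnorm (f x) <= k * rnorm x.

Let fr x : R := complex.Re (f x).
Let rip x y : R := complex.Re '[x, y].
Let phi x : R := rnorm x ^+ 2 - 2 * fr x.

Let frD x y : fr (x + y) = fr x + fr y.
Proof. by rewrite /fr -[x]scale1r f_lin mul1r scale1r raddfD. Qed.

Let frZ (a : R) x : fr (a%:C *: x) = a * fr x.
Proof.
rewrite /fr -[_ *: _]addr0 f_lin.
have -> : f 0 = 0 by have := f_lin (-1) 0 0; rewrite scaler0 addr0 mulN1r addNr.
by rewrite addr0; case: (f x) => u v /=; rewrite mul0r subr0.
Qed.

Let frZi x : fr ('i%C *: x) = - complex.Im (f x).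
Proof.
rewrite /fr -[_ *: _]addr0 f_lin.
have -> : f 0 = 0 by have := f_lin (-1) 0 0; rewrite scaler0 addr0 mulN1r addNr.
by rewrite addr0; case: (f x) => u v /=; rewrite mul0r mul1r sub0r.
Qed.

Let ripDl x y z : rip (x + y) z = rip x z + rip y z.
Proof. by rewrite /rip linearDl raddfD. Qed.

Let ripDr x y z : rip z (x + y) = rip z x + rip z y.
Proof. by rewrite /rip linearDr raddfD. Qed.

Let ripZr (a : R) x y : rip x (a%:C *: y) = a * rip x y.
Proof.
rewrite /rip linearZr_LR /= -[Num.conj _]/((a%:C)^*).
by case: '[x, y] => u v /=; rewrite oppr0 mul0r subr0.
Qed.

Let ripZir x y : rip x ('i%C *: y) = complex.Im '[x, y].
Proof.
rewrite /rip linearZr_LR /= -[Num.conj _]/(('i%C)^*).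
by case: '[x, y] => u v /=; rewrite mul0r sub0r mulN1r opprK.
Qed.

Let ripC x y : rip x y = rip y x.
Proof. by rewrite /rip innerC; case: '[y, x]. Qed.

Let rip_sqr x : rip x x = rnorm x ^+ 2.
Proof. by rewrite /rip rnorm_sqr. Qed.

Let Re_le_rnorm (a : R[i]) : `|complex.Re a| <= rnorm a.
Proof. by rewrite -lecR -rnormE normc_ge_Re. Qed.

Let rip_le x y : `|rip x y| <= rnorm x * rnorm y.
Proof. exact: le_trans (Re_le_rnorm _) (cauchy_schwarz _ _). Qed.

Let rnormDZ x z (t : R) :
  rnorm (x + t%:C *: z) ^+ 2 = rnorm x ^+ 2 + t ^+ 2 * rnorm z ^+ 2 + 2 * t * rip x z.
Proof.
rewrite -!rip_sqr ripDl !ripDr (ripC (_ *: z) x) !ripZr (ripC (_ *: z) z) ripZr.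
by ring.
Qed.

Let phiDZ x z (t : R) :
  phi (x + t%:C *: z) = phi x + t ^+ 2 * rnorm z ^+ 2 + 2 * t * (rip x z - fr z).
Proof. by rewrite /phi rnormDZ frD frZ; ring. Qed.

Let phi_ge x : - k ^+ 2 <= phi x.
Proof.
have h : fr x <= k * rnorm x.
  by apply: le_trans (f_bnd x); apply: le_trans (Re_le_rnorm _); rewrite ler_norm.
by have := sqr_ge0 (rnorm x - k); rewrite /phi; move: h; nra.
Qed.

Let mu : R := inf (range phi).

Let has_inf_phi : has_inf (range phi).
Proof.
split; first by exists (phi 0), 0.
by exists (- k ^+ 2) => _ [x _ <-]; exact: phi_ge.
Qed.

Let mu_le x : mu <= phi x.
Proof. by apply: ge_inf; [exact: has_inf_phi.2|exists x]. Qed.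

Let near_min (d : R) : 0 < d -> exists x, phi x < mu + d.
Proof.
by move=> d0; have [_ [x _ <-] h] := inf_adherent d0 has_inf_phi; exists x.
Qed.

Let near_min_close (d : R) x y : phi x < mu + d -> phi y < mu + d ->
  rnorm (x - y) ^+ 2 <= 4 * d.
Proof.
move=> hx hy.
have := mu_le (x + (2^-1)%:C *: (y - x)); rewrite phiDZ.
have /(_ (y - x) 1) := phiDZ x; rewrite scale1r addrC subrK => e.
have -> : rnorm (x - y) = rnorm (y - x) by rewrite /rnorm distrC.
move: hx hy e; set N := rnorm (y - x) ^+ 2; lra.
Qed.

Let F : set_system H :=
  filter_from [set d : R | 0 < d] (fun d => [set x | phi x < mu + d]).

Let F_filter : ProperFilter F.
Proof.
suff FF : Filter F by apply: filter_from_proper => d /near_min[x hx]; exists x.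
apply: filter_from_filter; first by exists 1 => /=.
move=> d e d0 e0; exists (Num.min d e); first by rewrite /= lt_min d0.
by move=> x /= h; split; apply: lt_le_trans h _;
  rewrite lerD2l ge_min lexx ?orbT.
Qed.

Let half_lt (s : R) : 0 < s -> 4 * (s / 8) < s.
Proof. by move=> s0; lra. Qed.

Let F_cauchy : cauchy F.
Proof.
have ? := F_filter; apply: cauchy_exP => e e0.
have ee : e = (complex.Re e)%:C by rewrite RRe_real // gtr0_real.
set r := complex.Re e in ee; move: e0; rewrite ee ltcR => r0.
have d0 : 0 < r ^+ 2 / 8 by rewrite divr_gt0 ?exprn_gt0.
have [x hx] := near_min d0.
exists x, (r ^+ 2 / 8) => //= y hy.
rewrite -ball_normE /= rnormE ltcR -(@ltr_pXn2r _ 2) ?nnegrE ?rnorm_ge0 ?ltW //.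
apply: le_lt_trans (near_min_close hx hy) _.
by apply: half_lt; rewrite exprn_gt0.
Qed.

Let l : H := lim F.

Let l_near (d : R) : 0 < d -> exists2 x, phi x < mu + d & rnorm (l - x) < d.
Proof.
move=> d0; have ? := F_filter.
have Fl : F --> l by exact: cauchy_cvg.
have Fb : F (ball l d%:C).
  by apply: Fl; apply: nbhsx_ballx; rewrite ltcR.
have Fp : F [set x | phi x < mu + d] by exists d.
have [x [bx px]] := filter_ex (filterI Fb Fp).
by exists x => //; move: bx; rewrite -ball_normE /= rnormE ltcR.
Qed.

Let rip_l z : rip l z = fr z.
Proof.
set Z := rnorm z ^+ 2; have Z0 : 0 <= Z by rewrite sqr_ge0.
have h (e : R) : 0 < e -> e <= 1 -> (rip l z - fr z) ^+ 2 <= e * (4 * (Z + 1)).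
  move=> e0 e1; have [x px lx] := l_near e0.
  have hb : (rip x z - fr z) ^+ 2 <= e * (Z + 1).
    apply: quad_lower_bound => // t.
    by have := mu_le (x + t%:C *: z); rewrite phiDZ -/Z; move: px; lra.
  have hs : (rip (l - x) z) ^+ 2 <= e * Z.
    rewrite -real_normK ?num_real //.
    apply: (@le_trans _ _ ((rnorm (l - x) * rnorm z) ^+ 2)).
      by rewrite ler_pXn2r ?nnegrE ?mulr_ge0 ?rnorm_ge0 // rip_le.
    rewrite exprMn ler_wpM2r // expr2.
    have := rnorm_ge0 (l - x); move: lx e1; set N := rnorm _; nra.
  have -> : rip l z - fr z = (rip x z - fr z) + rip (l - x) z.
    by have := ripDl (l - x) x z; rewrite subrK => ->; ring.
  have := sqr_ge0 ((rip x z - fr z) - rip (l - x) z).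
  by move: hb hs; set b := rip x z - _; set c := rip (l - x) z; nra.
apply/eqP; rewrite -subr_eq0 -sqrf_eq0 eq_le sqr_ge0 andbT leNgt.
move: h; set q := _ ^+ 2 => h; apply/negP => q0.
have c0 : 0 < 4 * (Z + 1) by rewrite mulr_gt0 // ltr_wpDl.
have qc0 : 0 < q / (2 * (4 * (Z + 1))) by rewrite divr_gt0 // mulr_gt0.
have m0 : 0 < Num.min 1 (q / (2 * (4 * (Z + 1)))) by rewrite lt_min ltr01.
have {h} := h _ m0; rewrite ge_min lexx => /(_ isT).
apply/negP; rewrite -ltNge.
apply: (@le_lt_trans _ _ (q / (2 * (4 * (Z + 1))) * (4 * (Z + 1)))).
  by rewrite ler_wpM2r ?(ltW c0) // ge_min lexx orbT.
have -> : q / (2 * (4 * (Z + 1))) * (4 * (Z + 1)) = q / 2.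
  by field; rewrite gt_eqF // ltr_wpDl.
lra.
Qed.

Lemma riesz : exists y, forall x, f x = '[x, y].
Proof.
exists l => x; rewrite innerC.
have := rip_l x; have := rip_l ('i%C *: x); rewrite ripZir frZi /fr /rip.
by case: (f x) '[l, x] => [a b] [c d] /= -> ->; rewrite opprK.
Qed.

End Riesz.
Lemma op_bounded_ge0 T :
  exists2 k : R, 0 <= k & forall x, rnorm (T x) <= k * rnorm x.
Proof.
have [k Tk] := op_bounded T; exists (Num.max 0 k) => [|x].
  by rewrite le_max lexx.
by rewrite (le_trans (Tk x)) // ler_wpM2r ?rnorm_ge0 // le_max lexx orbT.
Qed.

Lemma adjoint_exists T : exists S, forall x y, '[T x, y] = '[x, S y].
Proof.
have [k k_ge0 Tk] := op_bounded_ge0 T.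
have /choice[g gP] : forall y, exists z, forall x, '[T x, y] = '[x, z].
  move=> y; apply: (@riesz _ (k * rnorm y)).
    by move=> a u v; rewrite linearP linearDl linearZl_LR.
  move=> x; apply: le_trans (cauchy_schwarz _ _) _.
  by rewrite mulrAC ler_wpM2r ?rnorm_ge0.
have inner_inj u v : (forall x, '[x, u] = '[x, v]) -> u = v.
  move=> uv; apply/eqP; rewrite -subr_eq0 -(dnorm_eq0 (inner H)).
  by rewrite linearBr /= uv subrr.
have g_lin : linear g.
  move=> a u v; apply: inner_inj => x.
  by rewrite -gP !linearDr /= !linearZr_LR /= !gP.
have g_bnd y : rnorm (g y) <= k * rnorm y.
  have [->|gy0] := eqVneq (rnorm (g y)) 0; first by rewrite mulr_ge0 ?rnorm_ge0.
  have gy_gt0 : 0 < rnorm (g y) by rewrite lt_def gy0 rnorm_ge0.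
  rewrite -(ler_pM2l gy_gt0) -expr2.
  have -> : rnorm (g y) ^+ 2 = rnorm '[T (g y), y].
    by rewrite gP rnorm_sqr {2}/rnorm ger0_norm // ler0c sqr_ge0.
  apply: le_trans (cauchy_schwarz _ _) _.
  by rewrite mulrCA mulrA ler_wpM2r ?rnorm_ge0.
exists (BoundedOp g_lin (ex_intro _ k g_bnd)) => x y.
exact: gP.
Qed.

Lemma boundedOp_eq T S : T =1 S -> T = S.
Proof.
case: T S => [f fl fb] [g gl gb] /= /funext fg; subst g.
by rewrite (Prop_irrelevance fl gl) (Prop_irrelevance fb gb).
Qed.

End Norm.

(* B(H) as a complex vector space and a ring whose product is composition. *)
Section OperatorAlgebra.
Variables (R : realType) (H : hilbertSpace R).
Implicit Types (T S U : boundedOp H) (a : R[i]).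

Fact op0_linear : linear (fun _ : H => 0 : H).
Proof. by move=> a x y; rewrite scaler0 addr0. Qed.

Fact op0_bounded : exists k : R, forall x : H, rnorm (0 : H) <= k * rnorm x.
Proof. by exists 0 => x; rewrite mul0r rnorm0. Qed.

Definition op0 : boundedOp H := BoundedOp op0_linear op0_bounded.

Fact op1_linear : linear (fun x : H => x).
Proof. by []. Qed.

Fact op1_bounded : exists k : R, forall x : H, rnorm x <= k * rnorm x.
Proof. by exists 1 => x; rewrite mul1r. Qed.

Definition op1 : boundedOp H := BoundedOp op1_linear op1_bounded.

Fact op_scale_linear a T : linear (fun x => a *: T x).
Proof. by move=> b x y; rewrite linearP scalerDr !scalerA mulrC. Qed.

Fact op_scale_bounded a T :
  exists k : R, forall x : H, rnorm (a *: T x) <= k * rnorm x.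
Proof.
have [k _ Tk] := op_bounded_ge0 T; exists (rnorm a * k) => x.
by rewrite rnormZ -mulrA ler_wpM2l ?rnorm_ge0.
Qed.

Definition op_scale a T : boundedOp H :=
  BoundedOp (op_scale_linear a T) (op_scale_bounded a T).

Definition op_opp T : boundedOp H := op_scale (-1) T.

Fact op_add_linear T S : linear (fun x => T x + S x).
Proof. by move=> b x y; rewrite !linearP scalerDr addrACA. Qed.

Fact op_add_bounded T S :
  exists k : R, forall x : H, rnorm (T x + S x) <= k * rnorm x.
Proof.
have [k Tk] := op_bounded T; have [m Sm] := op_bounded S; exists (k + m) => x.
by rewrite (le_trans (rnormD _ _)) // mulrDl lerD.
Qed.

Definition op_add T S : boundedOp H :=
  BoundedOp (op_add_linear T S) (op_add_bounded T S).

Fact op_comp_linear T S : linear (fun x => T (S x)).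
Proof. by move=> b x y; rewrite !linearP. Qed.

Fact op_comp_bounded T S :
  exists k : R, forall x : H, rnorm (T (S x)) <= k * rnorm x.
Proof.
have [k k0 Tk] := op_bounded_ge0 T; have [m Sm] := op_bounded S.
by exists (k * m) => x; rewrite (le_trans (Tk _)) // -mulrA ler_wpM2l.
Qed.

Definition op_comp T S : boundedOp H :=
  BoundedOp (op_comp_linear T S) (op_comp_bounded T S).

HB.instance Definition _ := gen_eqMixin (boundedOp H).
HB.instance Definition _ := gen_choiceMixin (boundedOp H).

Fact op_addA : associative op_add.
Proof. by move=> T S U; apply: boundedOp_eq => x /=; rewrite addrA. Qed.

Fact op_addC : commutative op_add.
Proof. by move=> T S; apply: boundedOp_eq => x /=; rewrite addrC. Qed.

Fact op_add0 : left_id op0 op_add.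
Proof. by move=> T; apply: boundedOp_eq => x /=; rewrite add0r. Qed.

Fact op_addN : left_inverse op0 op_opp op_add.
Proof. by move=> T; apply: boundedOp_eq => x /=; rewrite scaleN1r addNr. Qed.

HB.instance Definition _ :=
  GRing.isZmodule.Build (boundedOp H) op_addA op_addC op_add0 op_addN.

Fact op_scaleA a b T : op_scale a (op_scale b T) = op_scale (a * b) T.
Proof. by apply: boundedOp_eq => x /=; rewrite scalerA. Qed.

Fact op_scale1 : left_id 1 op_scale.
Proof. by move=> T; apply: boundedOp_eq => x /=; rewrite scale1r. Qed.

Fact op_scaleDr : right_distributive op_scale +%R.
Proof. by move=> a T S; apply: boundedOp_eq => x /=; rewrite scalerDr. Qed.

Fact op_scaleDl T : {morph op_scale^~ T : a b / a + b}.
Proof. by move=> a b; apply: boundedOp_eq => x /=; rewrite scalerDl. Qed.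

HB.instance Definition _ := GRing.Zmodule_isLmodule.Build R[i] (boundedOp H)
  op_scaleA op_scale1 op_scaleDr op_scaleDl.

Fact op_compA : associative op_comp.
Proof. by move=> T S U; apply: boundedOp_eq. Qed.

Fact op_comp1l : left_id op1 op_comp.
Proof. by move=> T; apply: boundedOp_eq. Qed.

Fact op_comp1r : right_id op1 op_comp.
Proof. by move=> T; apply: boundedOp_eq. Qed.

Fact op_compDl : left_distributive op_comp +%R.
Proof. by move=> T S U; apply: boundedOp_eq. Qed.

Fact op_compDr : right_distributive op_comp +%R.
Proof. by move=> T S U; apply: boundedOp_eq => x /=; rewrite linearD. Qed.

HB.instance Definition _ := GRing.Zmodule_isPzRing.Build (boundedOp H)
  op_compA op_comp1l op_comp1r op_compDl op_compDr.

Lemma opDE T S x : (T + S) x = T x + S x. Proof. by []. Qed.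
Lemma opNE T x : (- T) x = - T x. Proof. exact: scaleN1r. Qed.
Lemma opZE a T x : (a *: T) x = a *: T x. Proof. by []. Qed.
Lemma op1E x : (1 : boundedOp H) x = x. Proof. by []. Qed.
Lemma opME T S x : (T * S) x = T (S x). Proof. by []. Qed.

Definition adjoint T : boundedOp H := sval (cid (adjoint_exists T)).

Lemma adjointP T x y : '[T x, y] = '[x, adjoint T y].
Proof. by rewrite /adjoint; case: cid. Qed.

Definition reOp T : boundedOp H := 2^-1 *: (T + adjoint T).

Definition imOp T : boundedOp H := (2 * 'i%C)^-1 *: (T - adjoint T).

Definition cOp (M m : R) T : boundedOp H :=
  (M%:C *: (1 : boundedOp H) - adjoint T) * (T - m%:C *: (1 : boundedOp H)).

(* The order of R[i] makes 0 <= z assert in particular that z is real. *)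
Definition positive_semidef T : Prop := forall x : H, 0 <= '[T x, x].

Definition accretive T : Prop := positive_semidef (reOp T).

Definition opnorm T : R := sup [set rnorm (T x) | x in [set x : H | rnorm x <= 1]].

(* On the zero space there is no unit vector; sup set0 = 0 is then the value. *)
Definition numerical_radius T : R :=
  sup [set rnorm '[T x, x] | x in [set x : H | rnorm x = 1]].

Lemma opnorm_has_sup T :
  has_sup [set rnorm (T x) | x in [set x : H | rnorm x <= 1]].
Proof.
split; first by exists (rnorm (T 0)), 0; rewrite //= rnorm0.
have [k k0 Tk] := op_bounded_ge0 T; exists k => _ [x /= x1 <-].
by rewrite (le_trans (Tk x)) // ler_piMr.
Qed.

Lemma numerical_radius_has_ubound T :
  has_ubound [set rnorm '[T x, x] | x in [set x : H | rnorm x = 1]].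
Proof.
have [k _ Tk] := op_bounded_ge0 T; exists k => _ [x /= x1 <-].
rewrite (le_trans (cauchy_schwarz _ _)) // x1 mulr1.
by rewrite (le_trans (Tk x)) // x1 mulr1.
Qed.

End OperatorAlgebra.

(* Main.v *)
Require Import Defs.
From mathcomp Require Import all_boot all_order all_algebra complex.
From mathcomp Require Import all_classical all_reals topology normedtype.
From mathcomp Require Import ring lra.

Import Order.TTheory GRing.Theory Num.Theory.
Local Open Scope ring_scope.
Local Open Scope complex_scope.

(** Fix a unit vector [x] and put [z = '[A x, x]], so that
    [Re z = '[reOp A x, x]] and [Im z = '[imOp A x, x]].  Since
    [Re '[cOp M m T x, x] = (M + m) Re '[T x, x] - M m - |T x|^2], accretivity
    of [cOp M m T] puts [T x] in the ball with diameter [m x, M x]; with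
    Cauchy-Schwarz and the arithmetic-geometric mean inequality this gives
    [2 sqrt(M m) |'[T x, x]| <= (M + m) Re '[T x, x]]
    (lemma [accretive_cOp_inner_le]).  For [T = A] the right-hand side is at
    most [(M + m) |reOp A|].  For [T = 'i A^*] the number ['[T x, x]] is
    ['i z^*], which has the modulus of [z] and real part [Im z], so the
    right-hand side is at most [(M + m) |imOp A|].  The product of the two
    bounds on [|z|] bounds [|z|^2], and the theorem follows by taking square
    roots and the supremum over [x]. *)

Section QuadraticForms.
Set Implicit Arguments.
Unset Strict Implicit.
Variables (R : realType) (H : hilbertSpace R).
Implicit Types (x y : H) (T : boundedOp H).

Lemma adjointPl T x y : '[adjoint T x, y] = '[x, T y].
Proof. by rewrite innerC -adjointP -innerC. Qed.

Lemma inner_reOp T x : '[reOp T x, x] = (complex.Re '[T x, x])%:C.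
Proof.
rewrite /reOp opZE opDE linearZl_LR linearDl /= adjointPl [in '[x, T x]]innerC.
by rewrite ReJ_add mulrC.
Qed.

Lemma inner_imOp T x : '[imOp T x, x] = (complex.Im '[T x, x])%:C.
Proof.
rewrite /imOp opZE opDE opNE linearZl_LR linearBl /= adjointPl.
rewrite [in '[x, T x]]innerC.
have ii0 : (2 * 'i%C : R[i]) != 0.
  by rewrite mulf_neq0 ?pnatr_eq0 // complexiE neq0Ci.
by rewrite subcJ mulrAC mulKf.
Qed.

Lemma Re_inner_cOp (M m : R) T x :
  complex.Re '[cOp M m T x, x] =
  (M + m) * complex.Re '[T x, x] - M * m * rnorm x ^+ 2 - rnorm (T x) ^+ 2.
Proof.
have -> : '[cOp M m T x, x] =
    M%:C * ('[T x, x] - m%:C * '[x, x]) - ('[T x, T x] - m%:C * ('[T x, x])^*).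
  rewrite /cOp opME !opDE !opNE !opZE !op1E linearBl linearZl_LR /= adjointPl.
  by rewrite !linearBl /= !linearZl_LR /= [in LHS](innerC x (T x)).
rewrite !rnorm_sqr; case: '[T x, x] => a b /=; ring.
Qed.

Lemma real_inner_le_opnorm T x (a : R) :
  rnorm x = 1 -> '[T x, x] = a%:C -> a <= opnorm T.
Proof.
move=> x1 Txx; have aTx : `|a| <= rnorm (T x).
  rewrite -[leRHS]mulr1 -x1; apply: le_trans (cauchy_schwarz _ _).
  by rewrite -lecR -rnormE Txx normc_def /= expr0n addr0 sqrtr_sqr.
apply: le_trans (ler_norm a) (le_trans aTx _).
apply: ub_le_sup; first exact: (opnorm_has_sup T).2.
by exists x; rewrite //= x1.
Qed.

Lemma Re_inner_le_opnorm T x :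
  rnorm x = 1 -> complex.Re '[T x, x] <= opnorm (reOp T).
Proof. by move=> x1; apply: real_inner_le_opnorm x1 (inner_reOp T x). Qed.

Lemma Im_inner_le_opnorm T x :
  rnorm x = 1 -> complex.Im '[T x, x] <= opnorm (imOp T).
Proof. by move=> x1; apply: real_inner_le_opnorm x1 (inner_imOp T x). Qed.

(** Accretivity of [cOp M m T] reads
    [|T x|^2 + M m <= (M + m) Re '[T x, x]] on unit vectors; the left-hand side
    is at least [|'[T x, x]|^2 + sqrt(M m)^2] by Cauchy-Schwarz, hence at least
    twice the product of the two squared numbers. *)
Lemma accretive_cOp_inner_le (M m : R) T x :
  0 <= M * m -> accretive (cOp M m T) -> rnorm x = 1 ->
  2 * Num.sqrt (M * m) * rnorm '[T x, x] <= (M + m) * complex.Re '[T x, x].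
Proof.
move=> Mm0 /(_ x); rewrite inner_reOp ler0c Re_inner_cOp => h x1.
have cs := cauchy_schwarz (T x) x; move: h cs; rewrite x1 expr1n !mulr1.
have w0 := rnorm_ge0 '[T x, x]; have := sqr_sqrtr Mm0.
have := sqr_ge0 (Num.sqrt (M * m) - rnorm '[T x, x]).
move: w0; set w := rnorm '[T x, x]; set s := Num.sqrt _; set n := rnorm (T x).
set p := _ * complex.Re _ => w0 sq sE h wn.
have : w ^+ 2 <= n ^+ 2 by rewrite ler_pXn2r ?nnegrE ?rnorm_ge0.
by move: sq; rewrite sqrrB -sE in h *; lra.
Qed.

Lemma inner_iadjoint T x : '[('i%C *: adjoint T) x, x] = 'i%C * ('[T x, x])^*.
Proof. by rewrite opZE linearZl_LR /= adjointPl innerC. Qed.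

End QuadraticForms.

Theorem theorem3p1 (R : realType) (H : hilbertSpace R) (M m : R)
    (A : boundedOp H) :
  0 < m -> m < M ->
  accretive (cOp M m A) -> accretive (cOp M m ('i%C *: adjoint A)) ->
  numerical_radius A <=
    (M + m) / (2 * Num.sqrt (M * m)) *
    Num.sqrt (opnorm (reOp A) * opnorm (imOp A)).
Proof.
move=> m0 mM accA acciA; have M0 : 0 < M by exact: lt_trans mM.
have Mm0 : 0 < M * m by rewrite mulr_gt0.
have s0 : 0 < 2 * Num.sqrt (M * m) by rewrite mulr_gt0 ?sqrtr_gt0.
set k := (M + m) / _; have k0 : 0 <= k by rewrite divr_ge0 ?ltW ?addr_gt0.
rewrite /numerical_radius; set S := (X in sup X).
(* Without unit vectors the numerical radius is [sup set0 = 0]. *)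
have [->|/set0P S0] := eqVneq S set0; first by rewrite sup0 mulr_ge0 ?sqrtr_ge0.
apply: (ge_sup S0) => _ [x /= x1 <-]; set z := '[A x, x].
have zre : rnorm z <= k * opnorm (reOp A).
  rewrite /k mulrAC ler_pdivlMr // [rnorm z * _]mulrC.
  have h := accretive_cOp_inner_le (ltW Mm0) accA x1.
  apply: (le_trans h).
  by rewrite ler_wpM2l ?Re_inner_le_opnorm // ltW ?addr_gt0.
have zim : rnorm z <= k * opnorm (imOp A).
  rewrite /k mulrAC ler_pdivlMr // [rnorm z * _]mulrC.
  have := accretive_cOp_inner_le (ltW Mm0) acciA x1.
  rewrite inner_iadjoint -/z.
  have -> : rnorm ('i%C * z^*) = rnorm z.
    apply: complexI; rewrite -!rnormE normrM norm_conjC.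
    by rewrite normc_def /= expr0n add0r expr1n sqrtr1 mul1r.
  have -> : complex.Re ('i%C * z^*) = complex.Im z by case: (z) => a b /=; ring.
  move=> h; apply: (le_trans h).
  by rewrite ler_wpM2l ?Im_inner_le_opnorm // ltW ?addr_gt0.
have z0 := rnorm_ge0 z.
(* The square of the right-hand side is the product of the bounds of
   [zre] and [zim]. *)
rewrite -(ger0_norm k0) -sqrtr_sqr -(ger0_norm z0) -sqrtr_sqr.
rewrite -sqrtrM ?sqr_ge0 // ler_wsqrtr // !expr2 mulrACA.
exact: ler_pM.
Qed.
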